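(* Let $\mathcal{M}$ be the $[0,\infty]$-category with the same objects as the syntax category $\mathcal{L}$ and $\mathcal{M}(x,y)=-\ln\mathcal{L}(x,y)$, and let $\widehat{\mathcal{M}}$ be its category of $[0,\infty]$-copresheaves. The coproduct with trivial weights $w_1=w_2=0$ makes $\widehat{\mathcal{M}}$ into a commutative monoid. The map $[0,\infty]\times\widehat{\mathcal{M}}\to\widehat{\mathcal{M}}$, $(s,f)\mapsto s\odot f$, where $(s\odot f)(x)=f(x)+s$, makes $\widehat{\mathcal{M}}$ into a module over the semi-tropical semi-ring.
   Context: The syntax category $\mathcal{L}$ has as objects the expressions (texts) of a language and hom objects $\mathcal{L}(x,y):=\pi(y|x)\in[0,1]$, the probability that $y$ extends $x$, with $\pi(y|x)=0$ if $x$ is not a subtext of $y$, $\pi(x|x)=1$, and $\pi(z|y)\pi(y|x)\le\pi(z|x)$ for all $x,y,z$. With $-\ln0=\infty$, $\mathcal{M}$ satisfies $\mathcal{M}(x,x)=0$ and $\mathcal{M}(x,y)+\mathcal{M}(y,z)\ge\mathcal{M}(x,z)$. On $[0,\infty]$, addition satisfies $a+\infty=\infty+a=\infty$, and the internal hom is $[a,b]:=\max\{b-a,0\}$, with $[\infty,b]=0$ for all $b$. A $[0,\infty]$-copresheaf on $\mathcal{M}$ is a function $f\colon\mathcal{M}\to[0,\infty]$ with $\mathcal{M}(x,y)\ge[fx,fy]$ for all $x,y$; $\widehat{\mathcal{M}}$ is the set of these, with hom objects $\widehat{\mathcal{M}}(f,g)=\sup_x[fx,gx]$. The coproduct of $f,g\in\widehat{\mathcal{M}}$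 with trivial weights is $(f\oplus g)(c)=\min\{fc,gc\}$. The semi-tropical semi-ring is $([0,\infty],\oplus,\odot)$ with $s_1\oplus s_2=\min\{s_1,s_2\}$ and $s_1\odot s_2=s_1+s_2$ (additive identity $\infty$, multiplicative identity $0$). A module over a semi-ring is a commutative monoid with an action of the semi-ring (satisfying the usual module axioms). *)

(* Defs.v *)
From HB Require Import structures.
From mathcomp Require Import all_boot all_order all_algebra.
From mathcomp Require Import all_classical all_reals all_analysis.

Set Implicit Arguments.
Unset Strict Implicit.
Unset Printing Implicit Defensive.

Import Order.TTheory GRing.Theory Num.Theory.

Local Open Scope classical_set_scope.
Local Open Scope ring_scope.
Local Open Scope ereal_scope.

(* The interval [0, +oo].  Its order, sum, minimum and maximum are those of
   \bar R, reached through the coercion [nnval]. *)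
Record nnereal (R : realType) := NNEReal {
  nnval :> \bar R;
  nnval_ge0 : 0 <= nnval }.

HB.instance Definition _ (R : realType) := [isSub for @nnval R].
HB.instance Definition _ (R : realType) := [Choice of nnereal R by <:].

Section nnereal_ops.
Context {R : realType}.
Implicit Types a b : nnereal R.

Definition nn0 : nnereal R := NNEReal (lexx 0).
Definition nnoo : nnereal R := NNEReal (leey 0).

Definition nnadd a b : nnereal R :=
  NNEReal (adde_ge0 (nnval_ge0 a) (nnval_ge0 b)).

Lemma nnmin_subproof a b : 0 <= mine (a : \bar R) b.
Proof. by rewrite le_min !nnval_ge0. Qed.
Definition nnmin a b : nnereal R := NNEReal (nnmin_subproof a b).

Lemma ihom_subproof a b : 0 <= maxe ((b : \bar R) - a) 0.
Proof. by rewrite le_max lexx orbT. Qed.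

(* The case a = +oo needs no separate clause: b - +oo = -oo for every b,
   including +oo, see [ihomy]. *)
Definition ihom a b : nnereal R := NNEReal (ihom_subproof a b).

Lemma ihomy b : ihom nnoo b = nn0.
Proof.
apply/val_inj => /=; apply/max_idPr.
by case: b => -[b||] //= _; rewrite leNye.
Qed.

Lemma ihom_leP a b (c : \bar R) : 0 <= c ->
  (ihom a b <= c) = ((b : \bar R) <= c + a).
Proof.
case: a b => -[a||] //= a0 [[b||]] //= b0; case: c => [c||] //= c0;
  rewrite ge_max c0 andbT ?leeNy_eq ?leey ?leye_eq ?leNye //=.
by rewrite -!EFinD !lee_fin lerBlDr.
Qed.

(* Supremum in [0, +oo]: that of the empty set is 0, not -oo. *)
Lemma nnsup_subproof (A : set (nnereal R)) :
  0 <= ereal_sup (0 |` [set nnval a | a in A]).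
Proof. by apply: ereal_sup_ubound; left. Qed.
Definition nnsup (A : set (nnereal R)) : nnereal R :=
  NNEReal (nnsup_subproof A).

Lemma nnsup_leP (A : set (nnereal R)) (c : \bar R) : 0 <= c ->
  (nnsup A <= c) <-> (forall a, A a -> nnval a <= c).
Proof.
move=> c0; split=> [Ac a Aa|Ac].
  by apply: le_trans Ac; apply: ereal_sup_ubound; right; exists a.
by apply: ge_ereal_sup => _ [->//|[a Aa <-]]; exact: Ac.
Qed.

End nnereal_ops.

Definition semitropical (R : realType) := nnereal R.

HB.instance Definition _ (R : realType) := Choice.on (semitropical R).

Section semitropical_semiring.
Context {R : realType}.
Implicit Types a b c : semitropical R.

Fact st_addA : associative (nnmin : semitropical R -> _ -> semitropical R).
Proof. by move=> a b c; apply/val_inj; exact: minA. Qed.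
Fact st_addC : commutative (nnmin : semitropical R -> _ -> semitropical R).
Proof. by move=> a b; apply/val_inj; exact: minC. Qed.
Fact st_add0 : left_id (nnoo : semitropical R) nnmin.
Proof. by move=> a; apply/val_inj/min_idPr; exact: leey. Qed.
Fact st_mulA : associative (nnadd : semitropical R -> _ -> semitropical R).
Proof. by move=> a b c; apply/val_inj; exact: addeA. Qed.
Fact st_mulC : commutative (nnadd : semitropical R -> _ -> semitropical R).
Proof. by move=> a b; apply/val_inj; exact: addeC. Qed.
Fact st_mul1 : left_id (nn0 : semitropical R) nnadd.
Proof. by move=> a; apply/val_inj; exact: add0e. Qed.
Fact st_mulDl :
  left_distributive (nnadd : semitropical R -> _ -> semitropical R) nnmin.
Proof.
move=> a b c; apply/val_inj => /=.
have [ab|/ltW ba] := leP (nnval a) (nnval b); apply/esym.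
  by apply/min_idPl; exact: leeD2r.
by apply/min_idPr; exact: leeD2r.
Qed.
Fact st_mul0 : left_zero (nnoo : semitropical R) nnadd.
Proof.
move=> a; apply/val_inj; apply: addye.
by rewrite gt_eqF// (lt_le_trans _ (nnval_ge0 a)).
Qed.

End semitropical_semiring.

HB.instance Definition _ (R : realType) :=
  GRing.isNmodule.Build (semitropical R) st_addA st_addC st_add0.
HB.instance Definition _ (R : realType) :=
  GRing.Nmodule_isComPzSemiRing.Build (semitropical R)
    st_mulA st_mulC st_mul1 st_mulDl st_mul0.

(* Categories enriched over [0, +oo] ordered by >=, with tensor product +. *)
Record nncategory (R : realType) := NNCategory {
  nnobj :> Type;
  nnhom : nnobj -> nnobj -> nnereal R;
  nnhom_refl : forall x, nnhom x x = nn0;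
  nnhom_triangle : forall x y z,
    (nnhom x z : \bar R) <= (nnhom x y : \bar R) + nnhom y z }.

(* Texts are an abstract set partially ordered by the subtext relation, which
   covers sets of strings over an alphabet ordered by factor inclusion.
   [extprob x y] is L(x, y) = pi(y|x). *)
Record syntax_category (R : realType) := SyntaxCategory {
  text :> Type;
  subtext : text -> text -> Prop;
  subtext_refl : forall x, subtext x x;
  subtext_anti : forall x y, subtext x y -> subtext y x -> x = y;
  subtext_trans : forall x y z, subtext x y -> subtext y z -> subtext x z;
  extprob : text -> text -> R;
  extprob_ge0 : forall x y, (0 <= extprob x y)%R;
  extprob_le1 : forall x y, (extprob x y <= 1)%R;
  extprob0 : forall x y, ~ subtext x y -> extprob x y = 0%R;
  extprob1 : forall x, extprob x x = 1%R;
  extprob_mul : forall x y z,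
    (extprob y z * extprob x y <= extprob x z)%R }.

Section metric_syntax_category.
Context {R : realType} (L : syntax_category R).
Implicit Types x y z : L.

Fact mhom_subproof x y : 0 <= - lne (extprob x y)%:E.
Proof.
rewrite oppe_ge0; have := extprob_ge0 x y; rewrite le_eqVlt => /predU1P[<-|p0].
  by rewrite le0_lneNy.
by rewrite lne_EFin// lee_fin ln_le0// extprob_le1.
Qed.

(* [lne] is the extended logarithm: lne 0 = -oo. *)
Definition mhom x y : nnereal R := NNEReal (mhom_subproof x y).

Fact mhom_refl x : mhom x x = nn0.
Proof. apply/val_inj; change (- lne (extprob x x)%:E = 0).
by rewrite extprob1 lne1 oppe0. Qed.

Fact mhom_triangle x y z :
  (mhom x z : \bar R) <= (mhom x y : \bar R) + mhom y z.
Proof.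
change (- lne (extprob x z)%:E <= - lne (extprob x y)%:E - lne (extprob y z)%:E).
have := extprob_ge0 x y; rewrite le_eqVlt => /predU1P[<-|xy0].
  rewrite (@le0_lneNy _ 0)// addye ?leey//.
  by rewrite gt_eqF// (lt_le_trans _ (mhom_subproof y z)).
have := extprob_ge0 y z; rewrite le_eqVlt => /predU1P[<-|yz0].
  rewrite (@le0_lneNy _ 0)// addey ?leey//.
  by rewrite gt_eqF// (lt_le_trans _ (mhom_subproof x y)).
have le_xz := extprob_mul x y z.
have xyz0 : (0 < extprob y z * extprob x y)%R by rewrite mulr_gt0.
have xz0 := lt_le_trans xyz0 le_xz.
rewrite !lne_EFin// -!EFinN -EFinD lee_fin -opprD lerN2 -lnM ?posrE//.
by rewrite ler_ln ?posrE ?mulr_gt0// mulrC.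
Qed.

Definition metric_category : nncategory R :=
  NNCategory mhom_refl mhom_triangle.

End metric_syntax_category.

Record copresheaf (R : realType) (C : nncategory R) := Copresheaf {
  cpval :> C -> nnereal R;
  cpvalP : forall x y, (ihom (cpval x) (cpval y) : \bar R) <= nnhom x y }.

Section copresheaf_category.
Context {R : realType} (C : nncategory R).

Definition cphom (f g : C -> nnereal R) : nnereal R :=
  nnsup [set ihom (f x) (g x) | x in [set: C]].

Lemma cphom_leP (f g : C -> nnereal R) (c : \bar R) : 0 <= c ->
  (cphom f g <= c) <-> (forall x, (g x : \bar R) <= c + f x).
Proof.
move=> c0; rewrite (nnsup_leP _ c0); split=> [fgc x|fgc _ [x _ <-]].
  by rewrite -ihom_leP//; apply: fgc; exists x.
by rewrite ihom_leP.
Qed.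

Fact cphom_refl (f : copresheaf C) : cphom f f = nn0.
Proof.
apply/val_inj/le_anti; rewrite nnval_ge0 andbT.
by apply/(cphom_leP _ _ (lexx 0)) => x; rewrite add0e.
Qed.

Fact cphom_triangle (f g h : copresheaf C) :
  (cphom f h : \bar R) <= (cphom f g : \bar R) + cphom g h.
Proof.
apply/cphom_leP => [|x]; first by rewrite adde_ge0// nnval_ge0.
have /(cphom_leP _ _ (nnval_ge0 _))/(_ x) fg := lexx (nnval (cphom f g)).
have /(cphom_leP _ _ (nnval_ge0 _))/(_ x) gh := lexx (nnval (cphom g h)).
apply: (le_trans gh); rewrite [X in _ <= X + _]addeC -addeA.
exact: leeD2l.
Qed.

Definition copresheaf_category : nncategory R :=
  NNCategory cphom_refl cphom_triangle.

Definition coprod (f g : C -> nnereal R) : C -> nnereal R :=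
  fun c => nnmin (f c) (g c).

Definition tscale (s : semitropical R) (f : C -> nnereal R) : C -> nnereal R :=
  fun x => nnadd (f x) s.

(* [coprod f g] has the universal property of the coproduct of f and g with
   trivial weights; the product in [0, +oo] is the maximum. *)
Lemma cphom_coprod (f g h : C -> nnereal R) :
  cphom (coprod f g) h = maxe (cphom f h : \bar R) (cphom g h) :> \bar R.
Proof.
have minP c x : ((h x : \bar R) <= c + coprod f g x) <->
    ((h x : \bar R) <= c + f x) /\ ((h x : \bar R) <= c + g x).
  rewrite /=; have [fg|/ltW gf] := leP (nnval (f x)) (nnval (g x)).
    by split=> [hf|[]//]; split=> //; apply: (le_trans hf); exact: leeD2l.
  by split=> [hg|[]//]; split=> //; apply: (le_trans hg); exact: leeD2l.
apply/le_anti/andP; split.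
  have m0 : 0 <= maxe (cphom f h : \bar R) (cphom g h).
    by rewrite le_max nnval_ge0.
  apply/(cphom_leP _ _ m0) => x; apply/minP; split.
    by move: x; apply/(cphom_leP _ _ m0); rewrite le_max lexx.
  by move: x; apply/(cphom_leP _ _ m0); rewrite le_max lexx orbT.
have c0 := nnval_ge0 (cphom (coprod f g) h).
have H := (cphom_leP _ _ c0).1 (lexx _).
by rewrite ge_max; apply/andP; split; apply/(cphom_leP _ _ c0) => x;
   have /minP[] := H x.
Qed.

End copresheaf_category.

(* Main.v *)
Require Import Defs.
From HB Require Import structures.
From mathcomp Require Import all_boot all_order all_algebra.
From mathcomp Require Import all_classical all_reals all_analysis.

Set Implicit Arguments.
Unset Strict Implicit.
Unset Printing Implicit Defensive.

Import Order.TTheory GRing.Theory Num.Theory.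
Local Open Scope ring_scope.

(** By the adjunction between [+] and the internal hom, being a copresheaf means
    [f y <= nnhom x y + f x] ([copresheaf_le]). This inequality survives pointwise minima and the
    addition of a constant, so both operations stay among copresheaves. Equality of copresheaves is
    pointwise ([copresheaf_ext]), hence each module axiom is a semi-ring law of [semitropical R]
    read at every point. *)

Section copresheaf_module.
Local Open Scope ereal_scope.
Context {R : realType} (C : nncategory R).
Implicit Types (f g h : copresheaf C) (s t : semitropical R).

HB.instance Definition _ := gen_eqMixin (copresheaf C).
HB.instance Definition _ := gen_choiceMixin (copresheaf C).

Lemma copresheaf_ext f g : f =1 g -> f = g.
Proof.
case: f g => [f fP] [g gP] /= /funext fg; rewrite -{}fg in gP *.
by congr Copresheaf; exact: Prop_irrelevance.
Qed.

Lemma copresheaf_le f (x y : C) : (f y : \bar R) <= nnhom x y + (f x : \bar R).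
Proof. by rewrite -ihom_leP ?nnval_ge0//; exact: cpvalP. Qed.

(** The constant infinity is the neutral element for minima; it is a copresheaf thanks to the
    convention that the internal hom out of infinity is 0. *)
Fact cpoo_subproof (x y : C) :
  (ihom (nnoo : nnereal R) nnoo : \bar R) <= nnhom x y.
Proof. by rewrite ihomy nnval_ge0. Qed.

Definition cpoo : copresheaf C := Copresheaf cpoo_subproof.

Fact cpmin_subproof f g (x y : C) :
  (ihom (coprod f g x) (coprod f g y) : \bar R) <= nnhom x y.
Proof.
rewrite ihom_leP ?nnval_ge0//= ge_min.
(* Whichever of [f], [g] attains the minimum at [x] also bounds the minimum at [y]. *)
by have [_|_] := leP (nnval (f x)) (nnval (g x)); rewrite copresheaf_le ?orbT.
Qed.

Definition cpmin f g : copresheaf C := Copresheaf (cpmin_subproof f g).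

Fact cpscale_subproof s f (x y : C) :
  (ihom (tscale s f x) (tscale s f y) : \bar R) <= nnhom x y.
Proof.
by rewrite ihom_leP ?nnval_ge0//= addeA; apply/leeD2r/copresheaf_le.
Qed.

Definition cpscale s f : copresheaf C := Copresheaf (cpscale_subproof s f).

Fact cpminA : associative cpmin.
Proof. by move=> f g h; apply: copresheaf_ext => x; exact: st_addA. Qed.

Fact cpminC : commutative cpmin.
Proof. by move=> f g; apply: copresheaf_ext => x; exact: st_addC. Qed.

Fact cpmin0 : left_id cpoo cpmin.
Proof. by move=> f; apply: copresheaf_ext => x; exact: st_add0. Qed.

HB.instance Definition _ :=
  GRing.isNmodule.Build (copresheaf C) cpminA cpminC cpmin0.

Fact cpscaleA s t f : cpscale s (cpscale t f) = cpscale (s * t)%R f.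
Proof.
(* Scalars are added on the right of [f x], so they accumulate in reverse order; commutativity
   repairs this. *)
rewrite mulrC; apply: copresheaf_ext => x.
exact/esym/(@mulrA (semitropical R)).
Qed.

(** Both zeros are infinite: the scalar is [nnoo], the copresheaf is [cpoo]. *)
Fact cpscale0 f : cpscale 0%R f = 0%R.
Proof.
by apply: copresheaf_ext => x; exact: (@mulr0 (semitropical R)).
Qed.

Fact cpscale1 : left_id 1%R cpscale.
Proof.
by move=> f; apply: copresheaf_ext => x; exact: (@mulr1 (semitropical R)).
Qed.

(** Adding a constant commutes with minima. The action is a right multiplication, hence the left
    distributive law. *)
Fact cpscaleDr : right_distributive cpscale +%R.
Proof.
by move=> s f g; apply: copresheaf_ext => x; exact: (@mulrDl (semitropical R)).
Qed.

Fact cpscaleDl f : {morph cpscale^~ f : s t / (s + t)%R}.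
Proof.
by move=> s t; apply: copresheaf_ext => x; exact: (@mulrDr (semitropical R)).
Qed.

HB.instance Definition _ :=
  GRing.Nmodule_isLSemiModule.Build (semitropical R) (copresheaf C)
    cpscaleA cpscale0 cpscale1 cpscaleDr cpscaleDl.

End copresheaf_module.

Theorem theorem6 (R : realType) (L : syntax_category R) :
  let M := metric_category L in
  let Mhat := copresheaf_category M in
  exists K : GRing.LSemiModule.axioms_ (semitropical R) Mhat,
    let V : lSemiModType (semitropical R) := GRing.LSemiModule.Pack K in
    (forall f g : copresheaf M,
       ((f : V) + (g : V) : copresheaf M) =1 coprod f g) /\
    (forall (s : semitropical R) (f : copresheaf M),
       (s *: (f : V) : copresheaf M) =1 tscale s f).
Proof.
(* The witness is the structure built above, taken at [metric_category L]; its operations compute to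
   [coprod] and [tscale]. *)
by exists (GRing.LSemiModule.class (copresheaf (metric_category L))).
Qed.
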